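(* Let $n\ge 2$. The number $nr'_=(n,1)$ of isomorphism classes of Steiner triple systems on $3^n$ points with $3$-rank exactly $3^n-n$ satisfies $$nr'_=(n,1)\ge \frac{12^{3^{n-2}(3^{n-1}-1)/2}}{6^{3^{n-1}}\cdot|AGL(n-1,3)|}-1.$$
   Context: The $3$-rank of a Steiner triple system is the rank over $\mathrm{GF}(3)$ of its block-by-point incidence matrix. $AGL(m,3)$ is the affine group of $\mathrm{GF}(3)^m$, of order $3^m\prod_{i=0}^{m-1}(3^m-3^i)$. *)

(* Defs.v *)
From mathcomp Require Import all_boot all_order all_algebra all_fingroup.

Set Implicit Arguments.
Unset Strict Implicit.
Unset Printing Implicit Defensive.

Import GRing.Theory.
Local Open Scope ring_scope.

Definition steiner_triple_system (T : finType) (B : {set {set T}}) : bool :=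
  [forall b in B, #|b| == 3%N] &&
  [forall x, forall y, (x != y) ==>
     (#|[set b in B | (x \in b) && (y \in b)]| == 1%N)].

Definition incidence_mx (v : nat) (B : {set {set 'I_v}}) :
    'M['F_3]_(#|B|, v) :=
  \matrix_(i < #|B|, j < v) (j \in (enum_val i : {set 'I_v}))%:R.

Definition rank3 (v : nat) (B : {set {set 'I_v}}) : nat :=
  \rank (incidence_mx B).

Definition isomorphic (T : finType) (B1 B2 : {set {set T}}) : bool :=
  [exists s : {perm T}, [set s @: (b : {set T}) | b in B1] == B2].

Lemma isomorphic_equiv (T : finType) : equivalence_rel (@isomorphic T).
Proof.
have sym : forall B1 B2 : {set {set T}},
    isomorphic B1 B2 -> isomorphic B2 B1.
  move=> B1 B2 /existsP[s /eqP <-]; apply/existsP; exists s^-1%g.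
  rewrite -imset_comp; apply/eqP; rewrite -[RHS]imset_id.
  apply: eq_imset => b /=; rewrite -imset_comp -[RHS]imset_id.
  by apply: eq_imset => x /=; rewrite permK.
have trans : forall B1 B2 B3 : {set {set T}},
    isomorphic B1 B2 -> isomorphic B2 B3 -> isomorphic B1 B3.
  move=> B1 B2 B3 /existsP[s /eqP <-] /existsP[t /eqP <-].
  apply/existsP; exists (s * t)%g; rewrite -imset_comp; apply/eqP.
  apply: eq_imset => b /=; rewrite -imset_comp.
  by apply: eq_imset => x /=; rewrite permM.
move=> B1 B2 B3; split=> [|B12].
  apply/existsP; exists 1%g; apply/eqP; rewrite -[RHS]imset_id.
  apply: eq_imset => b /=; rewrite -[RHS]imset_id.
  by apply: eq_imset => x /=; rewrite perm1.
by apply/idP/idP; apply: trans => //; apply: sym.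
Qed.

(* Every system on v points is isomorphic to one on 'I_v, so it suffices to
   count classes of systems with point set 'I_v. *)
Definition num_sts_classes (v r : nat) : nat :=
  #|equivalence_partition (@isomorphic 'I_v)
      [set B : {set {set 'I_v}} | steiner_triple_system B & rank3 B == r]|.

Definition AGL3 (m : nat) : {set {perm 'rV['F_3]_m}} :=
  [set s : {perm 'rV['F_3]_m} |
     [exists A : 'M['F_3]_m, (A \in unitmx) &&
       [exists c : 'rV['F_3]_m, forall x, s x == x *m A + c]]].

Lemma AGL3_group_set (m : nat) : group_set (AGL3 m).
Proof.
apply/group_setP; split=> [|s t].
  rewrite inE; apply/existsP; exists 1%:M; rewrite unitmx1 /=.
  by apply/existsP; exists 0; apply/forallP=> x; rewrite perm1 mulmx1 addr0.
rewrite !inE => /existsP[A /andP[uA /existsP[c /forallP sE]]].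
move=> /existsP[B /andP[uB /existsP[d /forallP tE]]].
apply/existsP; exists (A *m B); rewrite unitmx_mul uA uB /=.
apply/existsP; exists (c *m B + d); apply/forallP=> x.
by rewrite permM (eqP (tE _)) (eqP (sE _)) mulmxDl mulmxA addrA.
Qed.

Canonical AGL3_group (m : nat) := Group (AGL3_group_set m).

(* Main.v *)
Require Import Defs.
From mathcomp Require Import all_boot all_order all_algebra all_fingroup.
From mathcomp Require Import ring zify.

Set Implicit Arguments.
Unset Strict Implicit.
Unset Printing Implicit Defensive.

Import Order.TTheory GRing.Theory Num.Theory.
Local Open Scope ring_scope.

(* Let m = n - 1 and fiber the 3 ^ n points over W = GF(3)^m with fibers
   GF(3).  Take each fiber as a block and put a Latin square of order 3 on the
   three fibers over each line of W: the 12 ^ N resulting systems (N the number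
   of lines) have every affine function of W in their dual code, so their rank
   is at most 3 ^ n - n.  If some system has a further dual word f, then f is
   bijective on every fiber and the blocks are the triples on which both the
   projection to W and f sum to zero, so at most 6 ^ (3 ^ m) systems have rank
   below 3 ^ n - n.  An isomorphism between two systems of rank exactly
   3 ^ n - n preserves the dual code, hence acts on W as an affine
   transformation and permutes fibers, so each isomorphism class contains at
   most |AGL(m,3)| * 6 ^ (3 ^ m) of the systems. *)

(** * Three-element sets and Steiner triple systems *)

Lemma cards3P (T : finType) (x y : T) (b : {set T}) :
  #|b| = 3%N -> x != y -> x \in b -> y \in b ->
  exists z, [/\ z != x, z != y & b = [set x; y; z]].
Proof.
move=> b3 xy xb yb.
have : #|b :\: [set x; y]| = 1%N.
  by rewrite cardsD b3 (setIidPr _) ?cards2 ?xy //; apply/subsetP=> u /set2P[]->.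
move/eqP/cards1P=> [z Dz].
have : z \in b :\: [set x; y] by rewrite Dz set11.
rewrite !inE negb_or => /andP[/andP[zx zy] zb]; exists z; split=> //.
apply/eqP; rewrite eq_sym eqEcard b3 cardsU cards2 xy cards1.
rewrite (_ : _ :&: _ = set0) ?cards0 ?andbT; last first.
  by apply/setP=> u; rewrite !inE; case: (u =P z) => [->|]; rewrite ?(negPf zx) ?(negPf zy) ?andbF.
by apply/subsetP=> u; rewrite !inE => /orP[/orP[]|] /eqP->.
Qed.

Lemma cards_set3 (T : finType) (x y z : T) :
  x != y -> z != x -> z != y -> #|[set x; y; z]| = 3%N.
Proof.
move=> xy zx zy; rewrite setUC cardsU1 cards2 xy !inE.
by rewrite (negPf zx) (negPf zy).
Qed.

Lemma big_set3 (V : nmodType) (T : finType) (x y z : T) (F : T -> V) :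
  x != y -> z != x -> z != y ->
  \sum_(i in [set x; y; z]) F i = F x + F y + F z.
Proof.
move=> xy zx zy; rewrite setUC big_setU1 ?big_setU1 ?big_set1 ?inE //=.
- by rewrite addrC.
- by rewrite negb_or zx zy.
Qed.

Lemma stsP (T : finType) (B : {set {set T}}) :
  reflect [/\ forall b, b \in B -> #|b| = 3%N,
      forall x y, x != y -> exists2 b, b \in B & (x \in b) && (y \in b)
    & forall x y b b', x != y -> b \in B -> b' \in B -> x \in b -> y \in b ->
        x \in b' -> y \in b' -> b = b']
  (steiner_triple_system B).
Proof.
apply: (iffP andP) => [[/forall_inP b3 /forallP pr]|[b3 ex un]].
  split=> [b /b3/eqP //|x y xy|x y b b' xy Bb Bb' xb yb xb' yb'].
    have /forallP/(_ y) := pr x; rewrite xy /= => /cards1P[b Db].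
    have : b \in [set b] by rewrite set11.
    by rewrite -Db inE => /andP[Bb xyb]; exists b.
  have /forallP/(_ y) := pr x; rewrite xy /= => /cards1P[b0 Db].
  have : b \in [set b0] by rewrite -Db inE Bb xb yb.
  have : b' \in [set b0] by rewrite -Db inE Bb' xb' yb'.
  by move=> /set1P-> /set1P->.
split; first by apply/forall_inP=> b /b3->.
apply/forallP=> x; apply/forallP=> y; apply/implyP=> xy.
have [b Bb /andP[xb yb]] := ex x y xy; apply/cards1P; exists b.
apply/setP=> b'; rewrite !inE; apply/idP/eqP=> [/and3P[Bb' xb' yb']|->].
  exact: (un x y).
by rewrite Bb xb yb.
Qed.

Lemma sts_third (T : finType) (B : {set {set T}}) (x y : T) :
  steiner_triple_system B -> x != y ->
  exists z, [/\ z != x, z != y & [set x; y; z] \in B].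
Proof.
move=> /stsP[b3 ex _] xy; have [b Bb /andP[xb yb]] := ex x y xy.
have [z [zx zy Db]] := cards3P (b3 b Bb) xy xb yb.
by exists z; rewrite -Db.
Qed.

Lemma sts_third_uniq (T : finType) (B : {set {set T}}) (x y z z' : T) :
  steiner_triple_system B -> x != y -> z != x -> z != y ->
  [set x; y; z] \in B -> [set x; y; z'] \in B -> z = z'.
Proof.
move=> /stsP[_ _ un] xy zx zy Bz Bz'.
have := un x y _ _ xy Bz Bz'; rewrite !inE !eqxx !orbT /=.
move=> /(_ isT isT isT isT)/setP/(_ z); rewrite !inE eqxx orbT (negPf zx) (negPf zy).
by move/esym/eqP.
Qed.

(** * Triple systems of Steiner quasigroups *)

Section SteinerQuasigroup.
Variables (T : finType) (t : T -> T -> T).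
Hypothesis t_idem : forall x, t x x = x.
Hypothesis t_comm : forall x y, t x y = t y x.
Hypothesis t_inv : forall x y, t x (t x y) = y.

Definition sq_blocks : {set {set T}} :=
  [set [set p.1; p.2; t p.1 p.2] | p : T * T & p.1 != p.2].

Lemma sq_block_mem x y : x != y -> [set x; y; t x y] \in sq_blocks.
Proof. by move=> xy; apply/imsetP; exists (x, y); rewrite ?inE. Qed.

Lemma sq_neql x y : x != y -> t x y != x.
Proof. by apply: contra_neq => txy; rewrite -(t_inv x y) txy t_idem. Qed.

Lemma sq_neqr x y : x != y -> t x y != y.
Proof. by rewrite t_comm eq_sym; exact: sq_neql. Qed.

(** The three laws make [t] totally symmetric: from any two points of a block it returns the
    remaining one. *)
Lemma sq_blocksE b x y :
  x != y -> b \in sq_blocks -> x \in b -> y \in b -> b = [set x; y; t x y].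
Proof.
move=> xy /imsetP[[u w]]; rewrite inE /= => uw ->; rewrite !inE.
have tr : t w (t u w) = u by rewrite (t_comm u) t_inv.
move=> /orP[/orP[]|] /eqP Dx /orP[/orP[]|] /eqP Dy; rewrite ?Dx ?Dy in xy *;
  rewrite ?eqxx // in xy; rewrite ?t_inv ?(t_comm w u) ?(t_comm (t u w)) ?t_inv ?tr;
  by apply/setP=> v; rewrite !inE; do 3!case: (v == _).
Qed.

Lemma sq_blocks_sts : steiner_triple_system sq_blocks.
Proof.
apply/stsP; split=> [b /imsetP[[x y]]|x y xy|x y b b' xy Bb Bb' xb yb xb' yb'].
- by rewrite inE /= => xy ->; rewrite cards_set3 ?sq_neql ?sq_neqr.
- by exists [set x; y; t x y]; rewrite ?sq_block_mem // !inE !eqxx orbT.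
- by rewrite (sq_blocksE xy Bb xb yb) (sq_blocksE xy Bb' xb' yb').
Qed.

End SteinerQuasigroup.

(** * Lines of GF(3)^m and Latin squares of order 3 over them *)

Section Affine.
Variable m : nat.
Local Notation W := 'rV['F_3]_m.

Lemma add3F (a : 'F_3) : a + a + a = 0.
Proof. by case: a => [[|[|[|[]]]] //= lt]; apply: val_inj. Qed.

Lemma add3W (a : W) : a + a + a = 0.
Proof. by apply/rowP=> i; rewrite !mxE add3F. Qed.

(** In characteristic 3 three distinct points are collinear exactly when they sum to zero. For
    [a = b] the set collapses to a singleton, which [is_line] rejects. *)
Definition line (a b : W) : {set W} := [set a; b; - (a + b)].

Definition is_line (L : {set W}) : bool :=
  [exists p : W * W, (p.1 != p.2) && (L == line p.1 p.2)].

Lemma third_same (a : W) : - (a + a) = a.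
Proof. by apply/eqP; rewrite eqr_oppLR -addr_eq0 add3W. Qed.

Lemma line_same a : line a a = [set a].
Proof. by rewrite /line third_same !setUid. Qed.

Lemma third_neql (a b : W) : a != b -> - (a + b) != a.
Proof.
apply: contra_neq => h; apply: (addrI (a + a)).
by rewrite add3W -addrA -{1}h addNr.
Qed.

Lemma third_neqr (a b : W) : a != b -> - (a + b) != b.
Proof. by move=> ab; rewrite addrC third_neql // eq_sym. Qed.

Lemma lineC a b : line a b = line b a.
Proof. by rewrite /line addrC (setUC [set a]). Qed.

Lemma third_third (a b : W) : - (a - (a + b)) = b.
Proof. by rewrite opprB addrC addKr. Qed.

Lemma line_third a b : line a (- (a + b)) = line a b.
Proof. by rewrite /line third_third setUAC. Qed.

Lemma is_line_same a : is_line (line a a) = false.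
Proof.
apply/existsP=> -[[b c] /= /andP[bc /eqP/setP D]]; rewrite line_same in D.
have := D b; have := D c; rewrite !inE !eqxx orbT => /eqP Dc /eqP Db.
by rewrite Dc Db eqxx in bc.
Qed.

Lemma card_line a b : a != b -> #|line a b| = 3%N.
Proof.
by move=> ab; rewrite /line; apply: cards_set3; [|exact: third_neql|exact: third_neqr].
Qed.

Definition lineT := {L : {set W} | is_line L}.

(** Ordered pairs of distinct points are sorted by the line they span; those of one line lie inside
    it, so there are at most 6 of them. *)
Lemma card_lineT : (3 ^ m * (3 ^ m - 1) <= 6 * #|{: lineT}|)%N.
Proof.
pose D := [set p : W * W | p.1 != p.2].
have cW : #|{: W}| = (3 ^ m)%N by rewrite card_mx mul1n card_Fp.
have off (A : {set W}) :
    #|[set p in setX A A | p.1 != p.2]| = (#|A| * (#|A| - 1))%N.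
  have := cardsID [set p | p.1 == p.2] (setX A A).
  rewrite cardsX [X in (X + _)%N](_ : _ = #|A|); last first.
    have -> : setX A A :&: [set p | p.1 == p.2] = [set (x, x) | x in A].
      apply/setP=> -[x y]; rewrite !inE /=; apply/idP/imsetP => [|[z Az [-> ->]]].
        by case/andP=> /andP[Ax _] /eqP<-; exists x.
      by rewrite Az eqxx.
    by rewrite card_imset // => x y [].
  have -> : setX A A :\: [set p | p.1 == p.2] = [set p in setX A A | p.1 != p.2].
    by apply/setP=> -[x y]; rewrite !inE andbC.
  nia.
have DE : D = [set p in setX setT setT | p.1 != p.2].
  by apply/setP=> p; rewrite !inE.
rewrite -cW -cardsT -off -DE.
have <- : (\sum_(L : {set W} | is_line L) 6 = 6 * #|{: lineT}|)%N.
  by rewrite sum_nat_const card_sig mulnC.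
rewrite -sum1_card (partition_big (fun p => line p.1 p.2) is_line) /=.
  apply: leq_sum => L _; rewrite sum1_card.
  have [[a b]|e0] := pickP (fun p => (p \in D) && (line p.1 p.2 == L));
    last by rewrite eq_card0.
  rewrite inE /= => /andP[ab /eqP DL].
  have L3 : #|L| = 3%N by rewrite -DL card_line.
  have off6 : #|[set p in setX L L | p.1 != p.2]| = 6%N by rewrite off L3.
  rewrite -off6; apply/subset_leq_card/subsetP=> p.
  rewrite !inE /= => /andP[p12 /eqP <-]; rewrite inE in p12; rewrite p12 andbT.
  by rewrite !inE !eqxx !orbT.
by move=> p; rewrite inE => pD; apply/existsP; exists p; rewrite pD eqxx.
Qed.

(** An arbitrary choice of two points orders each line, which the normalization of signs requires.
    The default is reached only when [L] is not a line. *)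
Definition base (L : {set W}) : W * W :=
  odflt (0, 0) [pick p : W * W | (p.1 != p.2) && (L == line p.1 p.2)].

Lemma baseP L : is_line L ->
  (base L).1 != (base L).2 /\ L = line (base L).1 (base L).2.
Proof.
rewrite /base => /existsP[p Lp]; case: pickP => [q /andP[q12 /eqP Lq] //|].
by move/(_ p); rewrite Lp.
Qed.

(* Every Latin square of order 3 on the fibers over a line [L] is
   [eps_a x + eps_b y + eps_c z = k] with signs [eps], unique up to a common
   sign; the sign at the first base point is normalized to [1], leaving
   [2 * 2 * 3] choices. *)
Definition latin_choice := {ffun lineT -> (bool * bool) * 'F_3}.

(** The default [1], with [0] in [lshift], applies to the singletons [line a a]: there [lop] takes
    [i], [j] to [- (i + j)], so each fiber becomes a block. *)
Definition lsign (c : latin_choice) (L : {set W}) (w : W) : 'F_3 :=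
  if insub L is Some l then
    (-1) ^+ (if w == (base L).1 then false
             else if w == (base L).2 then (c l).1.1 else (c l).1.2)
  else 1.

Definition lshift (c : latin_choice) (L : {set W}) : 'F_3 :=
  if insub L is Some l then (c l).2 else 0.

Lemma lsign_sq c L w : lsign c L w * lsign c L w = 1.
Proof. by rewrite /lsign; case: insub => [l|]; rewrite ?mulr1 // -signr_addb addbb. Qed.

(** The Latin square equation solved for its third unknown; a sign is its own inverse. *)
Definition lop (c : latin_choice) (x y : W * 'F_3) : W * 'F_3 :=
  let L := line x.1 y.1 in let w := - (x.1 + y.1) in
  (w, lsign c L w * (lshift c L - lsign c L x.1 * x.2 - lsign c L y.1 * y.2)).

Lemma lop_idem c x : lop c x x = x.
Proof.
case: x => a i; rewrite /lop /= third_same /lsign /lshift insubF ?is_line_same //.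
by rewrite !mul1r sub0r; congr pair; apply/eqP; rewrite subr_eq eqr_oppLR -subr_eq0 opprK addrA add3F.
Qed.

Lemma lop_comm c x y : lop c x y = lop c y x.
Proof.
by rewrite /lop lineC [x.1 + y.1]addrC; congr pair; congr (_ * _); rewrite addrAC.
Qed.

Lemma lop_inv c x y : lop c x (lop c x y) = y.
Proof.
case: x y => [a i] [b j]; rewrite /lop /= line_third third_third.
congr pair; rewrite [lsign c _ (- _) * _]mulrA lsign_sq mul1r subKr.
by rewrite mulrA lsign_sq mul1r.
Qed.

Lemma sign_inj3 : injective (fun b : bool => (-1) ^+ b : 'F_3).
Proof. by move=> [] []. Qed.

Lemma lop_inj c c' : (forall x y, x.1 != y.1 -> lop c x y = lop c' x y) -> c = c'.
Proof.
move=> E; apply/ffunP=> -[L Ll]; have [ab DL] := baseP Ll.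
set a := (base L).1 in ab DL; set b := (base L).2 in ab DL.
have {}E i j := E (a, i) (b, j) ab.
move: E; rewrite /lop /= -DL /lsign /lshift !insubT -/a -/b eqxx.
rewrite (negPf (third_neql ab)) (negPf (third_neqr ab)) eqxx eq_sym (negPf ab).
set l : lineT := Sub L Ll; case: (c l) (c' l) => [[s1 s2] k] [[s1' s2'] k'] /=.
rewrite expr0 => E.
have {}E (i j : 'F_3) : (-1) ^+ s2 * (k - i - (-1) ^+ s1 * j)
             = (-1) ^+ s2' * (k' - i - (-1) ^+ s1' * j) :> 'F_3.
  by have /(congr1 snd) := E i j; rewrite /= !mul1r.
(* The values at (0, 0) and (1, 0) determine [s2] and then [k]; the value at (0, 1) determines
   [s1]. *)
have E0 := E 0 0; rewrite !subr0 !mulr0 !subr0 in E0.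
have E1 := E 1 0; rewrite !mulr0 !subr0 !mulrBr E0 !mulr1 in E1.
have /sign_inj3 s22 := oppr_inj (addrI _ E1).
have := E 0 1; rewrite -s22 in E0 *; move: E0 => /mulrI-> //.
  rewrite !subr0 !mulr1 => /mulrI; rewrite unitrX ?unitrN1 // => /(_ isT).
  by move/addrI/oppr_inj/sign_inj3->.
by rewrite unitrX ?unitrN1.
Qed.

End Affine.

(** * Systems fibered over GF(3)^m, with points read as pairs through [e] *)

Section Fibered.
Variables (m : nat) (X : finType).
Local Notation W := 'rV['F_3]_m.
Variables (e : X -> W * 'F_3) (e' : W * 'F_3 -> X).
Hypotheses (eK : cancel e e') (e'K : cancel e' e).

(** The sum condition makes every block project to a line or to a single point, and says that each
    coordinate of the projection is a dual word. *)
Definition fibered (B : {set {set X}}) : bool :=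
  steiner_triple_system B && [forall b in B, \sum_(x in b) (e x).1 == 0].

Definition latin_sts (c : latin_choice m) : {set {set X}} :=
  sq_blocks (fun x y => e' (lop c (e x) (e y))).

Section LatinSts.
Variable c : latin_choice m.
Let t x y := e' (lop c (e x) (e y)).

Let t_idem x : t x x = x.
Proof. by rewrite /t lop_idem eK. Qed.

Let t_comm x y : t x y = t y x.
Proof. by rewrite /t lop_comm. Qed.

Let t_inv x y : t x (t x y) = y.
Proof. by rewrite /t e'K lop_inv eK. Qed.

Lemma latin_sts_sts : steiner_triple_system (latin_sts c).
Proof. exact: sq_blocks_sts t_idem t_comm t_inv. Qed.

Lemma latin_sts_third x y : x != y ->
  [/\ t x y != x, t x y != y & [set x; y; t x y] \in latin_sts c].
Proof.
move=> xy; split; first exact: (sq_neql t_idem t_inv xy).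
  exact: (sq_neqr t_idem t_comm t_inv xy).
exact: (sq_block_mem t xy).
Qed.

Lemma latin_sts_fibered : fibered (latin_sts c).
Proof.
rewrite /fibered latin_sts_sts; apply/forall_inP=> b /imsetP[[x y]].
rewrite inE /= => xy ->.
have [tx ty _] := latin_sts_third xy.
by rewrite (big_set3 _ xy tx ty) /t e'K /= subrr.
Qed.

End LatinSts.

(** The system determines the third point of each block, hence [lop] on pairs from distinct fibers,
    and [lop_inj] recovers the choice. *)
Lemma latin_sts_inj : injective latin_sts.
Proof.
move=> c c' cc'; apply: lop_inj => x y xy.
have nxy : e' x != e' y by apply: contra_neq xy => /(can_inj e'K)->.
have [tx ty tB] := latin_sts_third c nxy.
have [_ _] := latin_sts_third c' nxy; rewrite -cc' => tB'.
have := sts_third_uniq (latin_sts_sts c) nxy tx ty tB tB'.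
by rewrite !e'K => /(can_inj e'K).
Qed.

Lemma card_fibered : (12 ^ #|{: lineT m}| <= #|[set B | fibered B]|)%N.
Proof.
have <- : #|{: latin_choice m}| = (12 ^ #|{: lineT m}|)%N.
  by rewrite card_ffun !card_prod card_bool card_Fp.
rewrite -cardsT -(card_imset _ latin_sts_inj); apply/subset_leq_card.
by apply/subsetP=> _ /imsetP[c _ ->]; rewrite inE latin_sts_fibered.
Qed.

(** * Dual words of fibered systems *)

Definition dual_word (B : {set {set X}}) (f : X -> 'F_3) : bool :=
  [forall b in B, \sum_(x in b) f x == 0].

Definition affine_word (f : X -> 'F_3) : bool :=
  [exists p : 'cV['F_3]_m * 'F_3, forall x, f x == ((e x).1 *m p.1) 0 0 + p.2].

(** Affine words are always dual to a fibered system, so for such systems this is equality of the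
    dual code with the affine words. *)
Definition affine_dual (B : {set {set X}}) : bool :=
  [forall f : {ffun X -> 'F_3}, dual_word B f ==> affine_word f].

Lemma affine_dualP B f : affine_dual B -> dual_word B f -> affine_word f.
Proof.
move=> /forallP/(_ (finfun f))/implyP aB /forall_inP df.
have /existsP[p /forallP fp] : affine_word (finfun f).
  apply/aB/forall_inP=> b /df/eqP s0; apply/eqP; rewrite -[RHS]s0.
  by apply: eq_bigr => x _; rewrite ffunE.
by apply/existsP; exists p; apply/forallP=> x; have := fp x; rewrite ffunE.
Qed.

Lemma fibered_third B x y : fibered B -> x != y ->
  exists z, [/\ z != x, z != y, [set x; y; z] \in B,
    (e z).1 = - ((e x).1 + (e y).1)
    & forall f, dual_word B f -> f z = - (f x + f y)].
Proof.
move=> /andP[sB /forall_inP fB] xy; have [z [zx zy Bz]] := sts_third sB xy.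
exists z; split=> // [|f /forall_inP/(_ _ Bz)].
  by have := fB _ Bz; rewrite big_set3 // addrC addr_eq0 => /eqP.
by rewrite big_set3 // addrC addr_eq0 => /eqP.
Qed.

(** Subtracting [h 0] leaves an additive function, and additive maps over a prime field are linear.
    The degenerate case [a = b] of the sum condition is automatic in characteristic 3. *)
Lemma sum_lines_affine (h : W -> 'F_3) :
  (forall a b, a != b -> h a + h b + h (- (a + b)) = 0) ->
  exists (u : 'cV['F_3]_m) (k : 'F_3), forall w, h w = (w *m u) 0 0 + k.
Proof.
move=> h3; pose g w := h w - h 0.
have g3 a b : g a + g b + g (- (a + b)) = 0.
  have -> : g a + g b + g (- (a + b)) =
     (h a + h b + h (- (a + b))) - (h 0 + h 0 + h 0) by rewrite /g; ring.
  by rewrite add3F subr0; have [->|/h3 //] := eqVneq a b; rewrite third_same add3F.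
have g0 : g 0 = 0 by rewrite /g subrr.
have gN a : g (- a) = - g a.
  by apply/eqP; rewrite -addr_eq0 addrC; have := g3 a 0; rewrite g0 !addr0 => ->.
have gD a b : g (a + b) = g a + g b.
  by apply/esym/eqP; rewrite -subr_eq0 -gN g3.
have gM (c : nat) a : g (a *+ c) = g a *+ c.
  by elim: c => [|c IHc]; rewrite ?mulr0n // !mulrS gD IHc.
have gZ (c : 'F_3) a : g (c *: a) = c * g a.
  by rewrite -[c]natr_Zp scaler_nat gM mulr_natl.
exists (\col_j g (delta_mx 0 j)), (h 0) => w; rewrite -[h w](subrK (h 0)); congr (_ + _).
rewrite -/(g w) {1}[w]row_sum_delta mxE.
rewrite (big_morph g gD g0); apply: eq_bigr => j _.
by rewrite gZ mxE.
Qed.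

Lemma F3_third (i j : 'F_3) : i != j -> exists k, forall l, [|| l == i, l == j | l == k].
Proof.
move=> ij; have c3 : #|[set: 'F_3]| = 3%N by rewrite cardsT card_Fp.
have [k [_ _ /setP D]] := cards3P c3 ij (in_setT i) (in_setT j).
by exists k => l; have := D l; rewrite !inE orbA => <-.
Qed.

(** Fix [y] over the third point of the line through [a] and [c]. Blocks through [y] and the fiber
    over [a] end in the fiber over [c], where [f] therefore takes all three values. *)
Lemma injective_fiber_spread B (f : X -> 'F_3) (a c : W) :
  fibered B -> dual_word B f ->
  injective (fun i => f (e' (a, i))) -> injective (fun i => f (e' (c, i))).
Proof.
move=> fB df fa; have [<- //|ac] := eqVneq a c.
set y := e' (- (a + c), 0).
suff im : (fun i => f (e' (c, i))) @: [set: 'F_3] = setT.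
  have /imset_injP ci : #|(fun i => f (e' (c, i))) @: [set: 'F_3]| == #|[set: 'F_3]|.
    by rewrite im.
  by move=> i j; apply: ci; rewrite inE.
apply/eqP; rewrite -subTset; apply/subsetP=> k _.
have [g _ gK] := injF_bij fa.
(* Chosen so that [f x = - k - f y], which forces the value [k] at the third point. *)
pose x := e' (a, g (- k - f y)).
have xy : x != y.
  rewrite /x /y (can_eq e'K) xpair_eqE negb_and.
  by rewrite eq_sym third_neql.
have [z [_ _ _ qz fz]] := fibered_third fB xy.
apply/imsetP; exists (e z).2; rewrite ?inE //.
have -> : c = (e z).1 by rewrite qz !e'K /= third_third.
rewrite -surjective_pairing eK (fz f df).
by rewrite /x gK subrK opprK.
Qed.

Lemma constant_fibers_affine B (f : X -> 'F_3) :
  fibered B -> dual_word B f -> (forall w i, f (e' (w, i)) = f (e' (w, 0))) ->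
  affine_word f.
Proof.
move=> fB df fc.
have [|u [k hu]] := @sum_lines_affine (fun w => f (e' (w, 0))).
  move=> a b ab.
  have xy : e' (a, 0) != e' (b, 0).
    by rewrite (can_eq e'K) xpair_eqE negb_and ab.
  have [z [_ _ _ qz fz]] := fibered_third fB xy.
  have := fz f df; rewrite -[z]eK [e z]surjective_pairing qz !e'K /= fc => ->.
  by rewrite subrr.
apply/existsP; exists (u, k); apply/forallP=> x /=.
by rewrite -hu -[in f x](eK x) {1}[e x]surjective_pairing fc.
Qed.

(** Two points of a fiber span the whole fiber as a block; if [f] agrees on them, the zero sum
    forces the same value on the third. *)
Lemma fiber_const_or_inj B (f : X -> 'F_3) (w : W) :
  fibered B -> dual_word B f ->
  injective (fun i => f (e' (w, i))) \/ (forall i, f (e' (w, i)) = f (e' (w, 0))).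
Proof.
move=> fB df.
have [/injectiveP|] := boolP (injectiveb (fun i => f (e' (w, i)))); first by left.
case/injectivePn=> i [j ij fij]; right.
have xy : e' (w, i) != e' (w, j).
  by rewrite (can_eq e'K) xpair_eqE negb_and ij orbT.
have [z [zx zy _ qz fz]] := fibered_third fB xy.
have Dz : z = e' (w, (e z).2).
  by rewrite -[LHS]eK [e z]surjective_pairing qz !e'K /= third_same.
have fzi : f z = f (e' (w, i)).
  rewrite (fz f df) -fij; apply/eqP; rewrite eqr_oppLR -addr_eq0.
  by rewrite add3F.
suff all_i l : f (e' (w, l)) = f (e' (w, i)) by move=> l; rewrite !all_i.
have [k D] := F3_third ij.
have Dk : (e z).2 = k.
  have := D (e z).2; case/or3P=> /eqP // E; move: zx zy; rewrite Dz E ?eqxx //.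
by have := D l; rewrite -Dk => /or3P[]/eqP-> //; rewrite -Dz.
Qed.

(** Under the bijection taking (w, i) to (w, [p w i]), these are the lines of the affine space
    GF(3)^(m+1). *)
Definition word_blocks (p : {ffun W -> {perm 'F_3}}) : {set {set X}} :=
  [set b : {set X} | [&& #|b| == 3%N, \sum_(x in b) (e x).1 == 0
    & \sum_(x in b) p (e x).1 (e x).2 == 0]].

(** A non-affine dual word is not constant on some fiber, hence injective on that one and then on
    all. Together with the projection it separates points, so the two zero sums pin down the third
    point of each block. *)
Lemma fibered_not_affine B : fibered B -> ~~ affine_dual B ->
  exists p, B = word_blocks p.
Proof.
move=> fB /forallPn[f]; rewrite negb_imply => /andP[df naf].
have inj_w w : injective (fun i => f (e' (w, i))).
  have [fc|/forallPn[a]] := boolP [forall a, [forall i, f (e' (a, i)) == f (e' (a, 0))]].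
    case/negP: naf; apply: (constant_fibers_affine fB df) => a i.
    by have /forallP/(_ i)/eqP := forallP fc a.
  case/forallPn=> i /eqP ai; apply: (injective_fiber_spread (a := a) fB df).
  by have [//|/(_ i)] := fiber_const_or_inj a fB df.
exists [ffun w => perm (inj_w w)]; apply/setP=> b.
have fE x : perm (inj_w (e x).1) (e x).2 = f x.
  by rewrite permE -surjective_pairing eK.
have sumE : \sum_(x in b) [ffun w => perm (inj_w w)] (e x).1 (e x).2 = \sum_(x in b) f x.
  by apply: eq_bigr => x _; rewrite ffunE fE.
rewrite inE sumE; have /andP[/stsP[b3 _ _] /forall_inP sq] := fB.
apply/idP/and3P=> [Bb|[/eqP cb /eqP qb /eqP fb]].
  by rewrite b3 // sq //; have /forall_inP-> := df.
have [x [y [xb yb xy]]] : exists x y, [/\ x \in b, y \in b & x != y].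
  by apply/card_gt1P; rewrite cb.
have [z [zx zy Db]] := cards3P cb xy xb yb.
have [z' [z'x z'y Bz' qz' fz']] := fibered_third fB xy.
have qz : (e z).1 = (e z').1.
  by rewrite qz'; apply/eqP; rewrite -addr_eq0 addrC -qb Db big_set3.
have fz : f z = f z'.
  by rewrite (fz' f df); apply/eqP; rewrite -addr_eq0 addrC -fb Db big_set3.
suff zz : z = z' by rewrite Db zz.
apply: (can_inj eK); rewrite [e z]surjective_pairing [e z']surjective_pairing -qz.
by congr pair; apply: (inj_w (e z).1); rewrite {2}qz -!surjective_pairing !eK.
Qed.

Lemma card_fiber_perms : #|{: {ffun W -> {perm 'F_3}}}| = (6 ^ 3 ^ m)%N.
Proof.
have p6 : #|{: {perm 'F_3}}| = 6%N.
  by rewrite -cardsT (eq_card (B := perm_on setT)) ?card_perm ?cardsT ?card_Fp // => s;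
     rewrite !inE; apply/esym/subsetP=> x _; rewrite inE.
by rewrite card_ffun p6 card_mx mul1n card_Fp.
Qed.

Lemma card_fibered_not_affine :
  (#|[set B | fibered B & ~~ affine_dual B]| <= 6 ^ 3 ^ m)%N.
Proof.
rewrite -card_fiber_perms -cardsT; apply: leq_trans (leq_imset_card word_blocks _).
apply/subset_leq_card/subsetP=> B; rewrite inE => /andP[fB nB].
by have [p ->] := fibered_not_affine fB nB; apply/imsetP; exists p.
Qed.

(** * Isomorphisms between fibered systems *)

Definition fiber_map (g : {perm W} * {ffun W -> {perm 'F_3}}) (x : X) : X :=
  e' (g.1 (e x).1, g.2 (e x).1 (e x).2).

(* Composing with [s] maps the dual code of the image system to that of [B];
   both consist of affine words, so [s] acts affinely on the fibers. *)
Lemma iso_fiber_map B (s : {perm X}) : fibered B -> affine_dual B ->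
  fibered [set s @: (b : {set X}) | b in B] ->
  exists2 g, g.1 \in AGL3 m & s =1 fiber_map g.
Proof.
move=> fB aB /andP[_ /forall_inP sq].
(* Each coordinate of the projection, composed with [s], is a dual word of [B], hence affine. *)
have aff (i : 'I_m) : exists p : 'cV['F_3]_m * 'F_3,
    forall x, (e (s x)).1 0 i = ((e x).1 *m p.1) 0 0 + p.2.
  have : affine_word (fun x => (e (s x)).1 0 i).
    apply: (affine_dualP aB); apply/forall_inP=> b Bb.
    have /eqP/rowP/(_ i) := sq _ (imset_f _ Bb).
    by rewrite big_imset /= ?summxE ?mxE => [->//|x y _ _ /perm_inj].
  by case/existsP=> p /forallP fp; exists p => x; apply/eqP.
have {aff} [p pE] := fin_all_exists aff.
pose A := \matrix_(j, i) (p i).1 j 0; pose k := \row_i (p i).2.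
have sE x : (e (s x)).1 = (e x).1 *m A + k.
  apply/rowP=> i; rewrite pE !mxE; congr (_ + _).
  by apply: eq_bigr => j _; rewrite mxE.
have uA : A \in unitmx.
  (* As [s] is onto, some point is sent over the [i]-th unit vector plus [k]; cancelling [k] puts
     that unit vector in the row space of [A]. *)
  rewrite -row_full_unit -sub1mx; apply/row_subP=> i.
  have : (e (s (s^-1 (e' (row i 1%:M + k, 0)))%g)).1 = row i 1%:M + k.
    by rewrite permKV e'K.
  by rewrite sE => /addIr <-; apply: submxMl.
have inj_a : injective (fun w : W => w *m A + k).
  by move=> w w' /addIr; apply: (can_inj (mulmxK uA)).
have inj_w w : injective (fun i => (e (s (e' (w, i)))).2).
  move=> i j ij; have : e (s (e' (w, i))) = e (s (e' (w, j))).
    by rewrite [LHS]surjective_pairing [RHS]surjective_pairing !sE !e'K ij.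
  by move/(can_inj eK)/perm_inj/(can_inj e'K) => -[].
exists (perm inj_a, [ffun w => perm (inj_w w)]) => [|x].
  rewrite inE; apply/existsP; exists A; rewrite uA.
  by apply/existsP; exists k; apply/forallP=> w; rewrite permE.
rewrite /fiber_map /= ffunE !permE -sE -surjective_pairing eK.
by rewrite -surjective_pairing eK.
Qed.

(** The fiber map carrying [B] to a system determines that system, so it suffices to count the
    affine parts and the families of fiber permutations. *)
Lemma card_fibered_iso B : fibered B -> affine_dual B ->
  (#|[set B' | fibered B' & isomorphic B B']| <= #|AGL3 m| * 6 ^ 3 ^ m)%N.
Proof.
move=> fB aB; rewrite -card_fiber_perms -cardsT -cardsX.
pose im g := [set fiber_map g @: (b : {set X}) | b in B].
apply: leq_trans (leq_imset_card im _).
apply/subset_leq_card/subsetP=> B'; rewrite inE => /andP[fB' /existsP[s /eqP Ds]].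
rewrite -Ds in fB' *; have [[a p] aA sg] := iso_fiber_map fB aB fB'.
apply/imsetP; exists (a, p); first by rewrite in_setX aA in_setT.
by apply: eq_imset => b; apply: eq_imset.
Qed.

End Fibered.

(** * The rank from the dual code, and the count of classes *)

Lemma rank3_affine_dual (m v : nat) (e : 'I_v -> 'rV['F_3]_m * 'F_3)
    (e' : 'rV['F_3]_m * 'F_3 -> 'I_v) (B : {set {set 'I_v}}) :
  cancel e' e -> fibered e B -> affine_dual e B -> rank3 B = (v - m.+1)%N.
Proof.
move=> e'K /andP[/stsP[b3 _ _] /forall_inP qB] aB.
pose Q : 'M['F_3]_(m, v) := \matrix_(j, x) (e x).1 0 j.
(* The rows, coordinate functions and the constant 1, span the affine words. *)
pose C : 'M['F_3]_(m + 1, v) := col_mx Q (const_mx 1).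
have mulE (u : 'rV['F_3]_v) (i : 'I_#|B|) :
    (u *m (incidence_mx B)^T) 0 i = \sum_(x in enum_val i) u 0 x.
  rewrite mxE [RHS]big_mkcond; apply: eq_bigr => x _; rewrite !mxE.
  by case: (x \in _); rewrite ?mulr1 ?mulr0.
have KC : (kermx (incidence_mx B)^T :=: C)%MS.
  apply/eqmxP/andP; split.
    apply/rV_subP=> u /sub_kermxP uK.
    have /existsP[[p k] /forallP uE] : affine_word e (fun x => u 0 x).
      apply: (affine_dualP aB); apply/forall_inP=> b Bb.
      have /rowP/(_ (enum_rank_in Bb b)) := uK.
      by rewrite mulE enum_rankK_in // mxE => /eqP.
    have -> : u = row_mx p^T (const_mx k) *m C.
      apply/rowP=> x; rewrite (eqP (uE x)) mul_row_col !mxE big_ord1 !mxE mulr1.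
      by congr (_ + _); apply: eq_bigr => j _; rewrite !mxE mulrC.
    exact: submxMl.
  apply/sub_kermxP/row_matrixP=> i; rewrite row_mul row0; apply/rowP=> j.
  rewrite mulE mxE; have Bb := enum_valP j.
  rewrite -[i]splitK; case: (split i) => k /=.
    rewrite (eq_bigr (fun x => (e x).1 0 k)) => [|x _]; last first.
      by rewrite mxE col_mxEu mxE.
    by have /eqP/rowP/(_ k) := qB _ Bb; rewrite summxE mxE.
  (* The constant word is dual because blocks have 3 points and 3 = 0 in the field. *)
  rewrite (eq_bigr (fun=> 1)) => [|x _]; last by rewrite mxE col_mxEd mxE.
  by rewrite sumr_const b3 // pchar_Zp.
(* A vanishing combination is an affine function that is zero on all of GF(3)^m, since the
   projection is onto; evaluating at 0 and at unit vectors kills its coefficients. *)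
have freeC : row_free C.
  rewrite -kermx_eq0; apply/eqP/row_matrixP => i0; apply/eqP; rewrite row0.
  have : (row i0 (kermx C) <= kermx C)%MS by exact: row_sub.
  move: (row i0 _) => u /sub_kermxP; rewrite -[u]hsubmxK mul_row_col => /rowP u0.
  have {}u0 (w : 'rV['F_3]_m) :
      \sum_j lsubmx u 0 j * w 0 j + rsubmx u 0 0 = 0.
    have := u0 (e' (w, 0)); rewrite !mxE big_ord1 !mxE mulr1 => E; rewrite -[RHS]E.
    by congr (_ + _); apply: eq_bigr => j _; rewrite !mxE e'K.
  have r0 : rsubmx u 0 0 = 0.
    have := u0 0; rewrite big1 ?add0r // => j _.
    by rewrite [(0 : 'rV__) _ _]mxE mulr0.
  have -> : rsubmx u = 0 by apply/rowP=> k; rewrite ord1 r0 mxE.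
  suff -> : lsubmx u = 0 by rewrite row_mx0.
  apply/rowP=> j; have := u0 (delta_mx 0 j); rewrite r0 addr0 (bigD1 j) //= big1.
    by rewrite [delta_mx _ _ _ _]mxE !eqxx mulr1 addr0 => ->; rewrite mxE.
  by move=> k kj; rewrite [delta_mx _ _ _ _]mxE (negPf kj) andbF mulr0.
have := mxrank_ker (incidence_mx B)^T; rewrite KC (eqP freeC) mxrank_tr /rank3.
(* The bound by [v] allows the truncated subtraction of rank-nullity to be inverted. *)
by have := rank_leq_col (incidence_mx B); lia.
Qed.

(** A class that meets [A] does so within the relatives of any one of its members in [A], hence in
    at most [k] elements. *)
Lemma card_equivalence_classes (T : finType) (R : rel T) (D A : {set T}) (k : nat) :
  equivalence_rel R -> A \subset D ->
  (forall x, x \in A -> #|[set y in A | R x y]| <= k)%N ->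
  (#|A| <= #|equivalence_partition R D| * k)%N.
Proof.
move=> eqR /subsetP AD leA; set P := equivalence_partition R D.
have /and3P[/eqP covP tiP _] : partition P D.
  by apply: equivalence_partitionP => x y z _ _ _; apply: eqR.
rewrite -sum1_card (partition_big (pblock P) [in P]) => [|x Ax]; last first.
  by apply: pblock_mem; rewrite covP AD.
rewrite -sum_nat_const; apply: leq_sum => S PS; rewrite sum1_card.
have [x /andP[Ax /eqP xS]|S0] := pickP (fun x => (x \in A) && (pblock P x == S)); last first.
  by rewrite eq_card0.
apply: leq_trans (leA x Ax); apply/subset_leq_card/subsetP=> y.
rewrite unfold_in inE => /andP[Ay /eqP yS]; rewrite Ay /=.
have eqD : {in D & &, equivalence_rel R} by move=> a b c _ _ _; apply: eqR.
rewrite -(pblock_equivalence_partition eqD) ?AD //.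
by rewrite -/P xS -yS mem_pblock covP AD.
Qed.

(* The division [%/ 2] in the exponent is exact: 3 ^ (n - 1) - 1 is even. *)
Theorem theorem4p5 (n : nat) (hn : (2 <= n)%N) :
  (12%:R ^+ ((3 ^ (n - 2) * (3 ^ (n - 1) - 1)) %/ 2)%N
     / (6%:R ^+ (3 ^ (n - 1))%N * #|AGL3 (n - 1)|%:R) - 1 : rat)
  <= (num_sts_classes (3 ^ n) (3 ^ n - n))%:R.
Proof.
have [m' ->] : exists m', n = m'.+2 by exists n.-2; lia.
set m := m'.+1.
have -> : (m.+1 - 2 = m')%N by rewrite !subSS subn0.
have -> : (m.+1 - 1 = m)%N by rewrite subSS subn0.
have cardE : #|'I_(3 ^ m.+1)| = #|{: 'rV['F_3]_m * 'F_3}|.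
  by rewrite card_ord card_prod card_mx mul1n card_Fp // expnSr.
pose e x := enum_val (cast_ord cardE (enum_rank x)).
pose e' p := enum_val (cast_ord (esym cardE) (enum_rank p)).
have eK : cancel e e' by move=> x; rewrite /e /e' enum_valK cast_ordK enum_rankK.
have e'K : cancel e' e by move=> x; rewrite /e /e' enum_valK cast_ordKV enum_rankK.
pose N := ((3 ^ m' * (3 ^ m - 1)) %/ 2)%N.
pose G := [set B | fibered e B & affine_dual e B].
pose D := [set B : {set {set 'I_(3 ^ m.+1)}} |
             steiner_triple_system B & rank3 B == (3 ^ m.+1 - m.+1)%N].
have leN : (12 ^ N <= #|[set B | fibered e B]|)%N.
  apply: leq_trans (card_fibered eK e'K); rewrite leq_exp2l //.
  (* The factor 3 completes [3 ^ m'] to [3 ^ m], matching the count of ordered pairs; dividing by 6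
     then gives [N] as a lower bound for the number of lines. *)
  have : (3 * (3 ^ m' * (3 ^ m - 1)) <= 6 * #|{: lineT m}|)%N.
    by rewrite mulnA -expnS; exact: card_lineT.
  by rewrite /N; move: (3 ^ m' * _)%N => u; lia.
have leG : (#|G| <= #|equivalence_partition (@isomorphic _) D| * (#|AGL3 m| * 6 ^ 3 ^ m))%N.
  apply: card_equivalence_classes; first exact: isomorphic_equiv.
    apply/subsetP=> B; rewrite !inE => /andP[fB aB].
    by rewrite (rank3_affine_dual e'K fB aB) eqxx andbT; case/andP: fB.
  move=> B; rewrite inE => /andP[fB aB].
  apply: leq_trans (card_fibered_iso eK e'K fB aB).
  by apply/subset_leq_card/subsetP=> B'; rewrite !inE => /andP[/andP[-> _] ->].
have main : (12 ^ N <= (num_sts_classes (3 ^ m.+1) (3 ^ m.+1 - m.+1)).+1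
                       * (6 ^ 3 ^ m * #|AGL3 m|))%N.
  apply: leq_trans leN _; rewrite -(cardsID [set B | affine_dual e B]).
  (* The systems with a further dual word number at most [6 ^ 3 ^ m], so they fit into one extra
     class bound because [AGL3 m] is nonempty. This is the successor here and the [- 1] of the
     theorem. *)
  have A0 : (0 < #|AGL3 m|)%N by exact: cardG_gt0.
  have bad := card_fibered_not_affine eK e'K.
  rewrite mulSn [X in (_ <= X)%N]addnC leq_add //.
    rewrite (_ : _ :&: _ = G); first by rewrite /num_sts_classes mulnC [(6 ^ _ * _)%N]mulnC mulnC.
    by apply/setP=> B; rewrite !inE.
  rewrite (_ : _ :\: _ = [set B | fibered e B & ~~ affine_dual e B]).
    by apply: leq_trans bad _; rewrite leq_pmulr.
  by apply/setP=> B; rewrite !inE andbC.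
rewrite lerBlDr natr1 ler_pdivrMr; last first.
  by rewrite mulr_gt0 ?exprn_gt0 ?ltr0n ?cardG_gt0.
by rewrite -!natrX -!natrM ler_nat.
Qed.
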